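(* There is an absolute constant $c>0$ such that for every positive integer $n\ge 2$, every positive semidefinite Hankel matrix $H\in\mathbb{R}^{n\times n}$ and every $\epsilon\in(0,1)$, there exists a Hankel matrix $\widehat{H}\in\mathbb{R}^{n\times n}$ of rank at most $c\log n\log(1/\epsilon)$ such that $$\|H-\widehat{H}\|_2\le\epsilon\|H\|_2\quad\text{and}\quad\|H-\widehat{H}\|_F\le\epsilon\|H\|_F.$$
   Context: A matrix $A\in\mathbb{R}^{n\times n}$ is Hankel if $A_{i,j}=A_{k,l}$ whenever $i+j=k+l$. $\|\cdot\|_2$ is the spectral norm and $\|\cdot\|_F$ the Frobenius norm. The paper states the rank bound as $O(\log n\log(1/\epsilon))$.
   Formalization: The rank bound is proved as c·log n·max(1, log(1/ε)) instead of c·log n·log(1/ε), since the latter fails as ε→1 (e.g. H the 2×2 identity forces Ĥ = 0); the two bounds agree for ε ≤ 1/e. *)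

(* Defs.v *)
From mathcomp Require Import all_boot all_order all_algebra.
From mathcomp Require Import all_classical all_reals all_analysis.

Set Implicit Arguments.
Unset Strict Implicit.
Unset Printing Implicit Defensive.

Import Order.TTheory GRing.Theory Num.Theory.

Local Open Scope classical_set_scope.
Local Open Scope ring_scope.

Definition is_hankel (R : realType) (n : nat) (A : 'M[R]_n) : Prop :=
  forall i j k l : 'I_n, (i + j = k + l)%N -> A i j = A k l.

Definition is_psd (R : realType) (n : nat) (A : 'M[R]_n) : Prop :=
  A^T = A /\ forall x : 'cV[R]_n, 0 <= (x^T *m A *m x) 0 0.

(* The library's norm `|x| on matrices is the max norm, hence these. *)
Definition vec_norm2 (R : realType) (n : nat) (x : 'cV[R]_n) : R :=
  Num.sqrt (\sum_(i < n) x i 0 ^+ 2).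

Definition spectral_norm (R : realType) (n : nat) (A : 'M[R]_n) : R :=
  sup [set vec_norm2 (A *m x) | x in [set x : 'cV[R]_n | vec_norm2 x <= 1]].

Definition frobenius_norm (R : realType) (n : nat) (A : 'M[R]_n) : R :=
  Num.sqrt (\sum_(i < n) \sum_(j < n) A i j ^+ 2).

(* The factor log(1/eps) inside O(log n log(1/eps)), read as
   max(1, log(1/eps)). With the bare logarithm, a bound of the form
   c log n log(1/eps) on all of 0 < eps < 1 would be unsatisfiable: it drops
   below 1 as eps tends to 1, forcing the zero matrix, whose relative error
   is 1. The two factors agree for eps <= 1/e. *)
Definition log_accuracy (R : realType) (eps : R) : R :=
  Num.max 1 (ln (1 / eps)).

(* Main.v *)
(* A positive semidefinite Hankel matrix is a moment matrix: writing
   [v(x) = (x^i)_i], one has [H = sum w v(x) v(x)^T + w' e e^T] with nonnegative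
   weights, where the last basis vector [e] plays the role of [v(oo)].  The signs
   [(-1)^i] and the reversal of indices are orthogonal congruences preserving the
   Hankel structure, so [H] is a sum of four positive semidefinite parts, each
   coming from atoms in [[0, 1]], and each part has norms at most those of [H].

   For atoms in [[0, 1]], expand [x^k = (y + (x - y))^k] binomially around the
   largest node [y = 1 - (3/4)^l <= x] with [l <= L = O(log n)] and keep [m] terms.
   All atoms with the same node then contribute a Hankel matrix of rank at most
   [m].  The tail is at most [2^-m (2x - y)^k = O(2^-m x^(k/2))], because
   [(2x - y)^2 <= x].  Hence the error is bounded entrywise by [O(2^-m)] times the
   matrix with entries [A_(i/2, j/2)], whose norms are at most twice those of [A];
   this comparison is what avoids a loss of a factor depending on [n]. *)

Require Import Defs.
From mathcomp Require Import all_boot all_order all_algebra.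
From mathcomp Require Import all_classical all_reals all_analysis.
From mathcomp Require Import fingroup perm complex ring lra zify.

Set Implicit Arguments.
Unset Strict Implicit.
Unset Printing Implicit Defensive.

Import Order.TTheory GRing.Theory Num.Theory.

Local Open Scope ring_scope.

(** * Spectral and Frobenius norms *)

(** Evaluate at the minimiser [- b / c]. The Cauchy-Schwarz inequalities below, for sums, for sums
    of squares of vectors and for the moment functional, are all instances. *)
Lemma discriminant_le0 (R : realFieldType) (a b c : R) : 0 <= c ->
  (forall t, 0 <= a + 2 * t * b + t ^+ 2 * c) -> b ^+ 2 <= a * c.
Proof.
move=> c0 q; case: (eqVneq c 0) => [c_eq0|cn0].
  rewrite c_eq0 mulr0; have [->|bn0] := eqVneq b 0; first by rewrite expr0n.
  (* For [c = 0] the form is affine in [t]; this [t] gives it the value -1. *)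
  have := q (- (a + 1) / (2 * b)); rewrite c_eq0 mulr0 addr0.
  have -> : a + 2 * (- (a + 1) / (2 * b)) * b = -1 by field.
  by rewrite lerNr oppr0 ler10.
have cp : 0 < c by rewrite lt_def cn0.
have := q (- b / c).
have -> : a + 2 * (- b / c) * b + (- b / c) ^+ 2 * c = (a * c - b ^+ 2) / c.
  by field.
by rewrite ler_pdivlMr// mul0r subr_ge0.
Qed.

Lemma cauchy_schwarz_sum (R : realFieldType) (I : finType) (a b : I -> R) :
  (\sum_i a i * b i) ^+ 2 <= (\sum_i a i ^+ 2) * (\sum_i b i ^+ 2).
Proof.
apply: discriminant_le0 => [|t]; first by apply: sumr_ge0 => i _; exact: sqr_ge0.
suff -> : \sum_i a i ^+ 2 + 2 * t * (\sum_i a i * b i)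
    + t ^+ 2 * (\sum_i b i ^+ 2) = \sum_i (a i + t * b i) ^+ 2.
  by apply: sumr_ge0 => i _; exact: sqr_ge0.
rewrite !mulr_sumr -!big_split /=; apply: eq_bigr => i _; ring.
Qed.

Definition sqnorm (R : realType) (n : nat) (x : 'cV[R]_n) : R :=
  \sum_(i < n) x i 0 ^+ 2.

Definition bil (R : realType) (n : nat) (y : 'cV[R]_n) (A : 'M[R]_n)
  (x : 'cV[R]_n) : R := \sum_(i < n) \sum_(j < n) y i 0 * A i j * x j 0.

Section Norms.
Variables (R : realType) (n : nat).
Implicit Types (A B E : 'M[R]_n) (x y : 'cV[R]_n).

Lemma bilE y A x : bil y A x = (y^T *m A *m x) 0 0.
Proof.
rewrite -mulmxA mxE; apply: eq_bigr => i _; rewrite !mxE mulr_sumr.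
by apply: eq_bigr => j _; rewrite mulrA.
Qed.

Lemma bil_mul y A x : bil y A x = \sum_i y i 0 * (A *m x) i 0.
Proof. by rewrite bilE -mulmxA mxE; apply: eq_bigr => i _; rewrite mxE. Qed.

Lemma bilD y A B x : bil y (A + B) x = bil y A x + bil y B x.
Proof. by rewrite !bilE mulmxDr mulmxDl mxE. Qed.

Lemma sqnorm_ge0 x : 0 <= sqnorm x.
Proof. by apply: sumr_ge0 => i _; exact: sqr_ge0. Qed.

Lemma sqnormE x : sqnorm x = (x^T *m x) 0 0.
Proof. by rewrite mxE; apply: eq_bigr => i _; rewrite mxE expr2. Qed.

Lemma vec_norm2_ge0 x : 0 <= vec_norm2 x.
Proof. exact: sqrtr_ge0. Qed.

Lemma sqr_vec_norm2 x : vec_norm2 x ^+ 2 = sqnorm x.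
Proof. by rewrite sqr_sqrtr// sqnorm_ge0. Qed.

Lemma frobenius_norm_ge0 A : 0 <= frobenius_norm A.
Proof. exact: sqrtr_ge0. Qed.

Lemma sqr_frobenius_norm A :
  frobenius_norm A ^+ 2 = \sum_i \sum_j A i j ^+ 2.
Proof.
rewrite sqr_sqrtr//; apply: sumr_ge0 => i _; apply: sumr_ge0 => j _.
exact: sqr_ge0.
Qed.

Lemma vec_norm2_le x (c : R) : 0 <= c -> sqnorm x <= c ^+ 2 -> vec_norm2 x <= c.
Proof.
by move=> c0; rewrite -sqr_vec_norm2 ler_sqr ?nnegrE ?vec_norm2_ge0.
Qed.

Lemma frobenius_norm_le A (c : R) : 0 <= c ->
  \sum_i \sum_j A i j ^+ 2 <= c ^+ 2 -> frobenius_norm A <= c.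
Proof.
by move=> c0; rewrite -sqr_frobenius_norm ler_sqr ?nnegrE ?frobenius_norm_ge0.
Qed.

Lemma dot_le x y : `|\sum_i y i 0 * x i 0| <= vec_norm2 y * vec_norm2 x.
Proof.
rewrite -ler_sqr ?nnegrE ?mulr_ge0 ?vec_norm2_ge0//.
by rewrite real_normK ?num_real// exprMn !sqr_vec_norm2 cauchy_schwarz_sum.
Qed.

Lemma vec_norm2_mulmx_le A x :
  vec_norm2 (A *m x) <= frobenius_norm A * vec_norm2 x.
Proof.
apply: vec_norm2_le; first by rewrite mulr_ge0 ?frobenius_norm_ge0 ?vec_norm2_ge0.
rewrite exprMn sqr_frobenius_norm sqr_vec_norm2 mulr_suml; apply: ler_sum => i _.
by rewrite mxE cauchy_schwarz_sum.
Qed.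

Lemma vec_norm2Z (a : R) x : vec_norm2 (a *: x) = `|a| * vec_norm2 x.
Proof.
rewrite /vec_norm2 -sqrtr_sqr -sqrtrM ?sqr_ge0//; congr Num.sqrt.
by rewrite mulr_sumr; apply: eq_bigr => i _; rewrite mxE exprMn.
Qed.

Lemma vec_norm2_0 : vec_norm2 (0 : 'cV[R]_n) = 0.
Proof. by rewrite -(scale0r 0) vec_norm2Z normr0 mul0r. Qed.

Lemma spectral_norm_ubound A :
  has_ubound [set vec_norm2 (A *m x) |
    x in [set x : 'cV[R]_n | vec_norm2 x <= 1]]%classic.
Proof.
exists (frobenius_norm A) => _ [x /= x1 <-].
apply: le_trans (vec_norm2_mulmx_le _ _) _.
by rewrite ler_piMr ?frobenius_norm_ge0.
Qed.

Lemma spectral_norm_ge0 A : 0 <= spectral_norm A.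
Proof.
apply: (ub_le_sup (spectral_norm_ubound A)).
by exists 0; rewrite /= ?mulmx0 vec_norm2_0.
Qed.

Lemma vec_norm2_mulmx A x :
  vec_norm2 (A *m x) <= spectral_norm A * vec_norm2 x.
Proof.
have [x0|xn0] := eqVneq (vec_norm2 x) 0.
  by apply: le_trans (vec_norm2_mulmx_le A x) _; rewrite x0 !mulr0.
have xp : 0 < vec_norm2 x by rewrite lt_def xn0 vec_norm2_ge0.
rewrite -ler_pdivrMr//; apply: (ub_le_sup (spectral_norm_ubound A)).
exists ((vec_norm2 x)^-1 *: x) => /=.
  by rewrite vec_norm2Z ger0_norm ?invr_ge0 ?vec_norm2_ge0// mulVf.
by rewrite -scalemxAr vec_norm2Z ger0_norm ?invr_ge0 ?vec_norm2_ge0// mulrC.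
Qed.

Lemma bil_le A x y :
  `|bil y A x| <= spectral_norm A * (vec_norm2 y * vec_norm2 x).
Proof.
rewrite bil_mul; apply: le_trans (dot_le _ _) _.
by rewrite mulrCA ler_wpM2l ?vec_norm2_ge0// vec_norm2_mulmx.
Qed.

(** Testing with [y = A *m x] gives [|A x|^2 <= c |A x| |x|], and one factor cancels. *)
Lemma spectral_norm_le A (c : R) : 0 <= c ->
  (forall x y, `|bil y A x| <= c * (vec_norm2 y * vec_norm2 x)) ->
  spectral_norm A <= c.
Proof.
move=> c0 bA; apply: ge_sup.
  by exists (vec_norm2 (A *m 0)), 0; rewrite /= ?vec_norm2_0.
move=> _ [x /= x1 <-].
have [->//|Axn0] := eqVneq (vec_norm2 (A *m x)) 0.
have Axp : 0 < vec_norm2 (A *m x) by rewrite lt_def Axn0 vec_norm2_ge0.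
have := bA x (A *m x); rewrite bil_mul.
under eq_bigr do rewrite -expr2.
rewrite ger0_norm ?sqnorm_ge0// -/(sqnorm _) -sqr_vec_norm2.
rewrite mulrCA expr2 ler_pM2l// => /le_trans; apply.
by rewrite ler_piMr.
Qed.

Lemma spectral_normD A B :
  spectral_norm (A + B) <= spectral_norm A + spectral_norm B.
Proof.
apply: spectral_norm_le => [|x y]; first by rewrite addr_ge0 ?spectral_norm_ge0.
by rewrite bilD mulrDl (le_trans (ler_normD _ _))// lerD ?bil_le.
Qed.

Lemma frobenius_normD A B :
  frobenius_norm (A + B) <= frobenius_norm A + frobenius_norm B.
Proof.
apply: frobenius_norm_le; first by rewrite addr_ge0 ?frobenius_norm_ge0.
have cs : \sum_i \sum_j A i j * B i j <= frobenius_norm A * frobenius_norm B.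
  apply: le_trans (ler_norm _) _.
  rewrite -ler_sqr ?nnegrE ?mulr_ge0 ?frobenius_norm_ge0//.
  rewrite real_normK ?num_real// exprMn !sqr_frobenius_norm !pair_bigA.
  exact: cauchy_schwarz_sum.
have -> : \sum_i \sum_j (A + B) i j ^+ 2 = \sum_i \sum_j A i j ^+ 2
    + 2 * (\sum_i \sum_j A i j * B i j) + \sum_i \sum_j B i j ^+ 2.
  rewrite mulr_sumr -!big_split /=; apply: eq_bigr => i _.
  rewrite mulr_sumr -!big_split /=; apply: eq_bigr => j _; rewrite mxE; ring.
rewrite -!sqr_frobenius_norm; lra.
Qed.

(** Positive semidefiniteness with an explicit certificate: closure under sums and congruences, and
    nonnegativity of the form, are read off the list. *)
Definition sum_of_squares A :=
  exists s : seq 'cV[R]_n, A = \sum_(u <- s) u *m u^T.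

Lemma sum_of_squaresD A B :
  sum_of_squares A -> sum_of_squares B -> sum_of_squares (A + B).
Proof. by move=> [s ->] [t ->]; exists (s ++ t); rewrite big_cat. Qed.

Lemma bil_sum (s : seq 'cV[R]_n) x y :
  bil y (\sum_(u <- s) u *m u^T) x
    = \sum_(u <- s) (y^T *m u) 0 0 * (x^T *m u) 0 0.
Proof.
rewrite bilE mulmx_sumr mulmx_suml summxE; apply: eq_bigr => u _.
rewrite mulmxA -mulmxA mxE big_ord1; congr (_ * _).
by rewrite -[u^T *m x]trmxK trmx_mul trmxK mxE.
Qed.

Lemma bil_sum_of_squares_ge0 A x : sum_of_squares A -> 0 <= bil x A x.
Proof.
by move=> [s ->]; rewrite bil_sum; apply: sumr_ge0 => u _; rewrite -expr2 sqr_ge0.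
Qed.

Lemma bil_sum_of_squares_CS A x y : sum_of_squares A ->
  bil y A x ^+ 2 <= bil y A y * bil x A x.
Proof.
move=> sA; apply: discriminant_le0 => [|t]; first exact: bil_sum_of_squares_ge0.
have := bil_sum_of_squares_ge0 (y + t *: x) sA.
case: sA => s ->; rewrite !bil_sum !mulr_sumr -!big_split /=.
rewrite (_ : \sum_(u <- s) _ = \sum_(i <- s)
   ((y^T *m i) 0 0 * (y^T *m i) 0 0 + 2 * t * ((y^T *m i) 0 0 * (x^T *m i) 0 0)
    + t ^+ 2 * ((x^T *m i) 0 0 * (x^T *m i) 0 0)))//.
apply: eq_bigr => u _; rewrite linearD/= linearZ/= mulmxDl -scalemxAl !mxE; ring.
Qed.

(** Cauchy-Schwarz for the form of [A] reduces the bound to diagonal values, which adding the form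
    of [B] can only increase. *)
Lemma spectral_norm_sum_of_squares_le A B :
  sum_of_squares A -> sum_of_squares B ->
  spectral_norm A <= spectral_norm (A + B).
Proof.
move=> sA sB; apply: spectral_norm_le => [|x y]; first exact: spectral_norm_ge0.
have qle z : bil z A z <= spectral_norm (A + B) * vec_norm2 z ^+ 2.
  rewrite expr2 (le_trans _ (le_trans (ler_norm _) (bil_le (A + B) z z)))//.
  by rewrite bilD lerDl bil_sum_of_squares_ge0.
rewrite -ler_sqr ?nnegrE ?mulr_ge0 ?vec_norm2_ge0 ?spectral_norm_ge0//.
rewrite real_normK ?num_real// (le_trans (bil_sum_of_squares_CS _ _ sA))//.
have := ler_pM (bil_sum_of_squares_ge0 y sA) (bil_sum_of_squares_ge0 x sA)
  (qle y) (qle x).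
move=> /le_trans; apply; rewrite le_eqVlt; apply/orP; left; apply/eqP; ring.
Qed.

(** The cross term in the square of [frobenius_norm (A + B)] is a sum of values [bil u A u] over the
    squares [u *m u^T] of [B], hence nonnegative. *)
Lemma frobenius_norm_sum_of_squares_le A B :
  sum_of_squares A -> sum_of_squares B ->
  frobenius_norm A <= frobenius_norm (A + B).
Proof.
move=> sA sB; apply: frobenius_norm_le; first exact: frobenius_norm_ge0.
have ip_ge0 : 0 <= \sum_i \sum_j A i j * B i j.
  case: sB => s ->.
  rewrite (_ : \sum_i _ = \sum_(u <- s) bil u A u).
    by apply: sumr_ge0 => u _; exact: bil_sum_of_squares_ge0.
  rewrite /bil [RHS]exchange_big; apply: eq_bigr => i _.
  rewrite [RHS]exchange_big; apply: eq_bigr => j _.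
  rewrite summxE mulr_sumr; apply: eq_bigr => u _.
  by rewrite !mxE big_ord1 !mxE mulrCA mulrA.
have -> : frobenius_norm (A + B) ^+ 2 = \sum_i \sum_j A i j ^+ 2
    + 2 * (\sum_i \sum_j A i j * B i j) + \sum_i \sum_j B i j ^+ 2.
  rewrite sqr_frobenius_norm mulr_sumr -!big_split /=; apply: eq_bigr => i _.
  rewrite mulr_sumr -!big_split /=; apply: eq_bigr => j _; rewrite mxE; ring.
rewrite -!sqr_frobenius_norm -[leLHS]addr0 -addrA lerD2l addr_ge0 ?sqr_ge0//.
by rewrite mulr_ge0.
Qed.

(** * Invariance under orthogonal congruence *)

Section Orthogonal.
Variable Q : 'M[R]_n.
Hypothesis QTQ : Q^T *m Q = 1%:M.

Lemma vec_norm2_orthogonal x : vec_norm2 (Q^T *m x) = vec_norm2 x.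
Proof.
rewrite /vec_norm2 -/(sqnorm _) -/(sqnorm x) !sqnormE trmx_mul trmxK.
by rewrite mulmxA -(mulmxA _ Q) (mulmx1C QTQ) mulmx1.
Qed.

Lemma spectral_norm_conj_le A : spectral_norm (Q *m A *m Q^T) <= spectral_norm A.
Proof.
apply: spectral_norm_le => [|x y]; first exact: spectral_norm_ge0.
rewrite bilE (_ : _ *m _ = (Q^T *m y)^T *m A *m (Q^T *m x)).
  by rewrite -bilE (le_trans (bil_le _ _ _))// !vec_norm2_orthogonal.
by rewrite trmx_mul trmxK !mulmxA.
Qed.

Lemma frobenius_norm_conj A : frobenius_norm (Q *m A *m Q^T) = frobenius_norm A.
Proof.
have frobE B : \sum_i \sum_j B i j ^+ 2 = \tr (B *m B^T).
  apply: eq_bigr => i _; rewrite mxE; apply: eq_bigr => j _.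
  by rewrite mxE expr2.
rewrite /frobenius_norm !frobE; congr Num.sqrt.
rewrite !trmx_mul trmxK -!mulmxA mxtrace_mulC -!mulmxA (mulmxA Q^T Q) QTQ.
by rewrite mul1mx mulmx1.
Qed.

Lemma sum_of_squares_conj A :
  sum_of_squares A -> sum_of_squares (Q *m A *m Q^T).
Proof.
move=> [s ->]; exists [seq Q *m u | u <- s]; rewrite big_map.
rewrite mulmx_sumr mulmx_suml; apply: eq_bigr => u _.
by rewrite trmx_mul !mulmxA.
Qed.

End Orthogonal.

Lemma spectral_norm_conj (Q A : 'M[R]_n) : Q^T *m Q = 1%:M ->
  spectral_norm (Q *m A *m Q^T) = spectral_norm A.
Proof.
move=> QTQ; apply/le_anti/andP; split; first exact: spectral_norm_conj_le.
have := @spectral_norm_conj_le Q^T; rewrite trmxK => /(_ (mulmx1C QTQ)).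
by move=> /(_ (Q *m A *m Q^T)); rewrite !mulmxA QTQ mul1mx -mulmxA QTQ mulmx1.
Qed.

End Norms.

(** * Moment representation of positive semidefinite Hankel matrices *)

(** A complex root [a + bi] exists. If it is not real, the remainder modulo [(X - a)^2 + b^2] is
    affine and vanishes at it, so it is zero. *)
Lemma real_poly_root_or_quadratic (R : realType) (p : {poly R}) : (1 < size p)%N ->
  (exists x, root p x) \/
  exists (a b : R) (q : {poly R}), b != 0 /\
    p = q * (('X - a%:P) ^+ 2 + (b ^+ 2)%:P).
Proof.
move=> sp.
pose f := [the {rmorphism R -> R[i]} of real_complex R].
have [[a b] rz] : exists z : R[i], root (map_poly f p) z.
  by apply/closed_rootP; rewrite size_map_poly; case: ltngtP sp.
have [b0|bn0] := eqVneq b 0.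
  left; exists a; move: rz; rewrite b0.
  by have -> : Complex a 0 = f a by []; rewrite fmorph_root.
right; set Q := ('X - a%:P) ^+ 2 + (b ^+ 2)%:P.
have szQ : size Q = 3%N.
  by rewrite size_polyDl size_exp_XsubC// (leq_ltn_trans (size_polyC_leq1 _)).
exists a, b, (p %/ Q); split=> //.
rewrite {1}(divp_eq p Q) [X in _ + X](_ : _ = 0) ?addr0//.
have : (size (p %% Q)%R <= 2)%N
  by rewrite -ltnS -szQ ltn_modp -size_poly_eq0 szQ.
have : root (map_poly f (p %% Q)) (Complex a b).
  move: rz; rewrite {1}(divp_eq p Q) rmorphD rmorphM /= /root hornerD hornerM.
  suff -> : (map_poly f Q).[Complex a b] = 0 by rewrite mulr0 add0r.
  rewrite rmorphD rmorphXn rmorphB /= map_polyX !map_polyC /= !hornerE.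
  rewrite expr2; apply/eqP; rewrite eq_complex /=; apply/andP; split; apply/eqP; ring.
set r := p %% Q => rr sr.
have rE : r = r`_1 *: 'X + (r`_0)%:P.
  apply/polyP => i; rewrite !coefE; case: i => [|[|i]]; rewrite ?mulr0 ?add0r ?mulr1 ?addr0 //=.
  by rewrite ?mulr0 ?addr0 nth_default// (leq_trans sr).
move: rr; rewrite rE rmorphD /= map_polyZ map_polyX map_polyC /= /root !hornerE.
rewrite eq_complex /= => /andP[/eqP Re /eqP Im].
have r1 : r`_1 = 0 by apply/eqP; move/eqP: Im; rewrite mul0r !addr0 mulf_eq0 (negPf bn0) orbF.
by move: Re; rewrite r1 !mul0r subr0 add0r => ->; rewrite scale0r add0r.
Qed.

(* Coefficients of index above [2 N] are ignored, so that [mom N h] is linear on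
   all polynomials. *)
Definition mom (R : realType) (N : nat) (h : nat -> R) (p : {poly R}) : R :=
  \sum_(k < N.*2.+1) p`_k * h k.

(** In the coefficients of [p], the form [L(p^2)] is that of the Hankel matrix with entries
    [h (i + j)], [i, j <= N]; [mom_kernel] describes its kernel. *)
Definition mom_psd (R : realType) (N : nat) (h : nat -> R) :=
  forall p : {poly R}, (size p <= N.+1)%N -> 0 <= mom N h (p * p).

Definition mom_kernel (R : realType) (N : nat) (h : nat -> R) (p : {poly R}) :=
  forall f : {poly R}, (size f <= N.+1)%N -> mom N h (p * f) = 0.

Section Moments.
Variables (R : realType) (N : nat).
Implicit Types (h : nat -> R) (p q f g : {poly R}).
Local Notation L := (mom N).

Lemma momD h p q : L h (p + q) = L h p + L h q.
Proof. by rewrite -big_split; apply: eq_bigr => k _; rewrite coefD mulrDl. Qed.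

Lemma momZ h (a : R) p : L h (a *: p) = a * L h p.
Proof. by rewrite mulr_sumr; apply: eq_bigr => k _; rewrite coefZ mulrA. Qed.

Lemma mom_sum h I (s : seq I) (F : I -> {poly R}) :
  L h (\sum_(i <- s) F i) = \sum_(i <- s) L h (F i).
Proof.
elim/big_rec2: _ => [|i x y _ <-]; last by rewrite momD.
by rewrite /mom big1// => k _; rewrite coef0 mul0r.
Qed.

Lemma momXn h k : (k <= N.*2)%N -> L h 'X^k = h k.
Proof.
move=> kN; rewrite /mom (bigD1 (Ordinal (kN : (k < N.*2.+1)%N)))//= coefXn eqxx mul1r.
rewrite big1 ?addr0// => i ik; rewrite coefXn; case: eqP => [e|]; last by rewrite mul0r.
by case/eqP: ik; apply: val_inj.
Qed.

Lemma mom_mul h p q : (size p <= N.+1)%N -> (size q <= N.+1)%N ->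
  L h (p * q) = \sum_(i < N.+1) \sum_(j < N.+1) p`_i * h (i + j)%N * q`_j.
Proof.
have polyE (r : {poly R}) : (size r <= N.+1)%N -> r = \sum_(i < N.+1) r`_i *: 'X^i.
  move=> sr; rewrite -(poly_def N.+1 (fun i => r`_i)); apply/polyP => i.
  by rewrite coef_poly; case: ltnP => // Ni; rewrite nth_default// (leq_trans sr).
move=> sp sq; rewrite [in LHS](polyE p sp) [in LHS](polyE q sq) mulr_suml mom_sum.
apply: eq_bigr => i _; rewrite mulr_sumr mom_sum; apply: eq_bigr => j _.
rewrite -scalerAl -scalerAr -exprD !momZ momXn ?mulrA; first by rewrite mulrAC.
by rewrite -addnn leq_add// -ltnS.
Qed.

Lemma mom_psd_CS h f g : mom_psd N h ->
  (size f <= N.+1)%N -> (size g <= N.+1)%N ->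
  L h (f * g) ^+ 2 <= L h (f * f) * L h (g * g).
Proof.
move=> psd sf sg; apply: discriminant_le0 => [|t]; first exact: psd.
have stg : (size (t *: g) <= N.+1)%N by rewrite (leq_trans (size_scale_leq _ _)).
have := psd (f + t *: g) (leq_trans (size_polyD _ _) _).
rewrite geq_max sf stg => /(_ isT).
have -> : (f + t *: g) * (f + t *: g) =
    f * f + (2 * t) *: (f * g) + (t ^+ 2) *: (g * g).
  by rewrite -!mul_polyC; rewrite polyCM polyC_exp; ring.
by rewrite !momD !momZ.
Qed.

Lemma mom_kernelP h q : mom_psd N h -> (size q <= N.+1)%N ->
  L h (q * q) = 0 -> mom_kernel N h q.
Proof.
move=> psd sq q0 f sf; have := mom_psd_CS psd sq sf; rewrite q0 mul0r.
by move=> /(conj (sqr_ge0 _))/andP/le_anti/eqP; rewrite eq_sym sqrf_eq0 => /eqP.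
Qed.

Lemma size_mulS p q : (size p <= N.+1)%N -> (size q <= N.+1)%N ->
  (size (p * q)%R <= N.*2.+1)%N.
Proof. by move=> sp sq; apply: leq_trans (size_polyMleq _ _) _; lia. Qed.

Lemma mom_sub_atom h (w x : R) p : (size p <= N.*2.+1)%N ->
  L (fun k => h k - w * x ^+ k) p = L h p - w * p.[x].
Proof.
move=> sp; rewrite (horner_coef_wide x sp) mulr_sumr -sumrB.
by apply: eq_bigr => k _; rewrite mulrBr mulrCA.
Qed.

Lemma mom_sub_top h (w : R) p : (size p <= N.*2.+1)%N ->
  L (fun k => h k - w * (k == N.*2)%:R) p = L h p - w * p`_N.*2.
Proof.
move=> sp; rewrite /mom (eq_bigr (fun k : 'I__ => p`_k * h k
  - w * (p`_k * (val k == N.*2)%:R))); last by move=> k _ /=; ring.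
rewrite sumrB -mulr_sumr; congr (_ - w * _).
rewrite big_ord_recr /= eqxx mulr1 big1 ?add0r// => k _.
by rewrite ltn_eqF ?mulr0.
Qed.

(** Moments of a finite measure on the projective line: the term with [w] is an atom at infinity,
    seen only by the top moment. *)
Definition atomic h := exists (s : seq (R * R)) (w : R),
  [/\ all (fun a => 0 <= a.1) s, 0 <= w &
      forall k, (k <= N.*2)%N ->
        h k = \sum_(a <- s) a.1 * a.2 ^+ k + w * (k == N.*2)%:R].

Lemma atomic_add_atom h (w x : R) : 0 <= w ->
  atomic (fun k => h k - w * x ^+ k) -> atomic h.
Proof.
move=> w0 [s [w' [s0 w'0 hE]]]; exists ((w, x) :: s), w'; split=> //=.
  by rewrite w0.
by move=> k kN; rewrite big_cons /= -addrA -hE// addrC subrK.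
Qed.

Lemma atomic_add_top h (w : R) : 0 <= w ->
  atomic (fun k => h k - w * (k == N.*2)%:R) -> atomic h.
Proof.
move=> w0 [s [w' [s0 w'0 hE]]]; exists s, (w' + w); split=> //=.
  by rewrite addr_ge0.
by move=> k kN; rewrite mulrDl addrA -hE// subrK.
Qed.

(* A constant in the kernel means that all the mass sits at infinity. *)
Lemma atomic_kernel1 h : mom_psd N h -> mom_kernel N h 1 -> atomic h.
Proof.
move=> psd k1.
(* Induction: the square of ['X^(i+1)] is ['X^i] times ['X^(i+2)], so its moment vanishes, and an
   isotropic polynomial lies in the kernel. *)
have kX i : (i < N)%N -> mom_kernel N h 'X^i.
  elim: i => [|i IH] iN; first by rewrite expr0.
  apply: mom_kernelP => //; first by rewrite size_polyXn; lia.
  have -> : 'X^(i.+1) * 'X^(i.+1) = 'X^i * 'X^(i.+2) :> {poly R}.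
    by rewrite -!exprD; congr (_ ^+ _); lia.
  by apply: IH; [lia|rewrite size_polyXn; lia].
have h0 k : (k < N.*2)%N -> h k = 0.
  move=> kN; rewrite -(momXn h (ltnW kN)).
  have -> : 'X^k = 'X^(minn k N.-1) * 'X^(k - minn k N.-1) :> {poly R}.
    by rewrite -exprD; congr (_ ^+ _); lia.
  by apply: kX; [lia|rewrite size_polyXn; lia].
exists [::], (h N.*2); split=> // [|k kN].
  rewrite -momXn// -addnn exprD; apply: psd; by rewrite size_polyXn.
rewrite big_nil add0r; case: eqP => [->|kn]; first by rewrite mulr1.
by rewrite mulr0 h0//; lia.
Qed.

(** Since [f - f(x)] is divisible by [X - x], [L(q f) = f(x) L(q)]. The weight [L(q) / q(x)] puts
    [q] in the new kernel, and Cauchy-Schwarz against [q] keeps the form positive. *)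
Lemma atomic_sub_root h q (x : R) : mom_psd N h -> (size q <= N)%N ->
  mom_kernel N h (q * ('X - x%:P)) -> 0 < L h (q * q) ->
  exists w : R, [/\ 0 <= w, mom_psd N (fun k => h k - w * x ^+ k) &
    mom_kernel N (fun k => h k - w * x ^+ k) q].
Proof.
move=> psd sq kp qq; have sq' : (size q <= N.+1)%N by rewrite ltnW.
have Lq f : (size f <= N.+1)%N -> L h (q * f) = f.[x] * L h q.
  move=> sf; have /factor_theorem[g gE] : root (f - f.[x]%:P) x.
    by rewrite /root !hornerE subrr.
  have sg : (size g <= N.+1)%N.
    have [->|gn0] := eqVneq g 0; first by rewrite size_poly0.
    have : (size (f - f.[x]%:P)%R <= N.+1)%N.
      rewrite (leq_trans (size_polyD _ _))// geq_max sf size_polyN.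
      by rewrite (leq_trans (size_polyC_leq1 _)).
    by rewrite gE size_Mmonic ?monicXsubC// size_XsubC addn2 /=; exact: ltnW.
  have -> : q * f = f.[x] *: q + q * ('X - x%:P) * g.
    rewrite -mulrA [_ * g]mulrC -gE -mul_polyC; ring.
  by rewrite momD momZ kp// addr0.
have Lqq := Lq q sq'.
have [qx0|qxn0] := eqVneq q.[x] 0.
  by move: qq; rewrite Lqq qx0 mul0r ltxx.
pose w := L h q / q.[x].
have wE : w = L h (q * q) / q.[x] ^+ 2 by rewrite Lqq /w; field.
have w0 : 0 <= w by rewrite wE divr_ge0 ?sqr_ge0 ?ltW.
exists w; split=> // [f sf|f sf].
  rewrite mom_sub_atom ?size_mulS// hornerM subr_ge0.
  have := mom_psd_CS psd sq' sf; rewrite Lq// -(ler_pM2l qq) wE.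
  have -> : L h (q * q) * (L h (q * q) / q.[x] ^+ 2 * (f.[x] * f.[x]))
      = (f.[x] * L h q) ^+ 2 by rewrite Lqq; field.
  by [].
by rewrite mom_sub_atom ?size_mulS// hornerM Lq// /w; field.
Qed.

(* A real root of a kernel polynomial splits off an atom, and a pair of complex
   roots can simply be discarded. *)
Lemma atomic_singular h p : mom_psd N h -> (size p <= N.+1)%N -> p != 0 ->
  mom_kernel N h p -> atomic h.
Proof.
have [m] := ubnP (size p); elim: m h p => // m IH h p /ltnSE spm psd sp pn0 kp.
have [sp1|sp1] := leqP (size p) 1.
  apply: atomic_kernel1 => // f sf; move: kp pn0; rewrite (size1_polyC sp1) polyC_eq0.
  move=> kp cn0; have := kp f sf; rewrite mul_polyC momZ mul1r => /eqP.
  by rewrite mulf_eq0 (negPf cn0) => /eqP.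
have [[x /factor_theorem[q pE]]|[a [b [q [bn0 pE]]]]] := real_poly_root_or_quadratic sp1.
  have qn0 : q != 0 by apply: contraNneq pn0; rewrite pE => ->; rewrite mul0r.
  have spq : size p = (size q).+1.
    by rewrite pE size_Mmonic ?monicXsubC// size_XsubC addn2.
  have sqN : (size q <= N)%N by rewrite -ltnS -spq.
  have sqN1 := leqW sqN.
  have [qq0|qq] := eqVneq (L h (q * q)) 0.
    by apply: (IH h q) => //; [rewrite -spq|exact: mom_kernelP].
  have [||w [w0 psd' k']] := @atomic_sub_root h q x psd sqN.
  - by rewrite -pE.
  - by rewrite lt_def qq psd.
  apply: (@atomic_add_atom h w x w0).
  by apply: (IH _ q) => //; rewrite -spq.
have qn0 : q != 0 by apply: contraNneq pn0; rewrite pE => ->; rewrite mul0r.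
have spq : size p = (size q).+2.
  have szQ : size (('X - a%:P) ^+ 2 + (b ^+ 2)%:P) = 3%N.
    by rewrite size_polyDl size_exp_XsubC// (leq_ltn_trans (size_polyC_leq1 _)).
  rewrite pE size_mul ?szQ ?addn3//.
  by rewrite -size_poly_eq0 szQ.
have sqN : ((size q).+1 <= N)%N by rewrite -ltnS -spq.
have sqN1 : (size q <= N.+1)%N by rewrite leqW// ltnW.
apply: (IH h q) => //; first by rewrite (leq_trans _ spm)// spq.
apply: mom_kernelP => //.
(* This value is [L(((X - a) q)^2) + b^2 L(q^2)] with both terms nonnegative, so [L(q^2) = 0]. *)
have : L h (p * q) = 0 by exact: kp.
have -> : p * q = (('X - a%:P) * q) * (('X - a%:P) * q) + (b ^+ 2) *: (q * q).
  by rewrite pE -mul_polyC; ring.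
have q0 : 0 <= L h (q * q) by exact: psd.
have q1 : 0 <= L h (('X - a%:P) * q * (('X - a%:P) * q)).
  by apply: psd; rewrite mulrC size_Mmonic ?monicXsubC// size_XsubC addn2 leqW.
rewrite momD momZ => /eqP; rewrite paddr_eq0 ?(mulr_ge0 (sqr_ge0 b) q0)//.
by rewrite mulf_eq0 sqrf_eq0 (negPf bn0) => /andP[_ /eqP].
Qed.

(** A singular Hankel matrix has a kernel vector, which feeds [atomic_singular]. An invertible one
    is first made singular by removing an atom at infinity. *)
Lemma atomic_psd h : mom_psd N h -> atomic h.
Proof.
move=> psd; pose H := \matrix_(i < N.+1, j < N.+1) h (i + j)%N.
pose pol (u : 'rV[R]_N.+1) : {poly R} := \poly_(i < N.+1) u 0 (inord i).
have polE u (i : 'I_N.+1) : (pol u)`_i = u 0 i.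
  by rewrite coef_poly ltn_ord inord_val.
have spol u : (size (pol u) <= N.+1)%N by exact: size_poly.
have LH u f : (size f <= N.+1)%N ->
    L h (pol u * f) = \sum_j (u *m H) 0 j * f`_j.
  move=> sf; rewrite mom_mul// exchange_big; apply: eq_bigr => j _ /=.
  rewrite mxE mulr_suml; apply: eq_bigr => i _.
  by rewrite polE mxE.
have [uH|sH] := boolP (H \in unitmx); last first.
  have : kermx H != 0.
    by rewrite kermx_eq0 row_free_unit.
  rewrite -nz_row_eq0; set u := nz_row _ => un0.
  have uH0 : u *m H = 0 by apply/eqP; rewrite -sub_kermx nz_row_sub.
  apply: (@atomic_singular h (pol u)) => // [|f sf].
    apply: contraNneq un0 => u0; apply/eqP/rowP => i.
    by rewrite -polE u0 coef0 mxE.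
  by rewrite LH// uH0 big1// => j _; rewrite mxE mul0r.
(* The solution of [u H = e_N] represents the functional that takes the coefficient of degree
   [N]. *)
pose u : 'rV[R]_N.+1 := delta_mx 0 ord_max *m invmx H.
have Lu f : (size f <= N.+1)%N -> L h (pol u * f) = f`_N.
  move=> sf; rewrite LH// mulmxKV// (bigD1 ord_max)//= mxE !eqxx mul1r.
  by rewrite big1 ?addr0// => j /negPf jN; rewrite mxE jN andbF mul0r.
have top f g : (size f <= N.+1)%N -> (size g <= N.+1)%N ->
    (f * g)`_N.*2 = f`_N * g`_N.
  move=> sf sg; rewrite coefM.
  have NN : (N < N.*2.+1)%N by lia.
  rewrite (bigD1 (Ordinal NN))//= [(N.*2 - N)%N](_ : _ = N); last by rewrite -addnn addnK.
  rewrite big1 ?addr0// => i iN.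
  have [Ni|iN'] := ltnP N i; first by rewrite nth_default ?mul0r// (leq_trans sf).
  rewrite [g`__]nth_default ?mulr0// (leq_trans sg)//.
  have : (i : nat) != N by [].
  by move: (i : nat) iN'; clear=> k; lia.
(* If [u_N = 0], then [L(u^2) = 0] and [u] is itself a kernel polynomial. *)
have [uN0|uNn0] := eqVneq (pol u)`_N 0.
  apply: (@atomic_singular h (pol u)) => //.
    apply/eqP => u0.
    have := Lu 'X^N; rewrite u0 mul0r size_polyXn coefXn eqxx => /(_ (leqnn _)).
    rewrite /mom big1 => [/eqP|k _]; last by rewrite coef0 mul0r.
    by rewrite eq_sym oner_eq0.
  by apply: mom_kernelP => //; rewrite Lu.
have uN : 0 < (pol u)`_N by rewrite lt_def uNn0 -Lu ?psd.
(* This weight puts [u] in the kernel: [f_N - w u_N f_N = 0] for all [f]. Positivity survives by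
   [f_N^2 <= u_N L(f^2)]. *)
pose w := ((pol u)`_N)^-1.
have w0 : 0 <= w by rewrite invr_ge0 ltW.
apply: (@atomic_add_top h w w0); apply: (@atomic_singular _ (pol u)) => //.
- move=> f sf; rewrite mom_sub_top ?size_mulS// top// subr_ge0.
  have := mom_psd_CS psd (spol u) sf; rewrite !Lu// -(ler_pM2l uN).
  by rewrite mulrA /w mulfV// mul1r expr2.
- by apply: contraNneq uNn0 => ->; rewrite coef0.
by move=> f sf; rewrite mom_sub_top ?size_mulS// top// Lu// /w mulrA mulVf// mul1r subrr.
Qed.

End Moments.

Lemma psd_hankel_atomic (R : realType) (N : nat) (H : 'M[R]_N.+1) :
  is_hankel H -> is_psd H -> exists (s : seq (R * R)) (w : R),
  [/\ all (fun a => 0 <= a.1) s, 0 <= w &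
      forall i j, H i j = \sum_(a <- s) a.1 * a.2 ^+ (i + j)
        + w * ((i + j)%N == N.*2)%:R].
Proof.
move=> hH [_ pH].
(* Reading antidiagonal [k] at row [min(k, N)] keeps both indices at most [N] for [k <= 2N]. *)
pose h k := H (inord (minn k N)) (inord (k - minn k N)).
have hE (i j : 'I_N.+1) : H i j = h (i + j)%N.
  by apply: hH; rewrite !inordK; have := ltn_ord i; have := ltn_ord j; lia.
have [|s [w [s0 w0 sE]]] := @atomic_psd R N h.
  move=> p sp; rewrite mom_mul//.
  have := pH (\col_i p`_i); rewrite -bilE /bil.
  congr (0 <= _); apply: eq_bigr => i _; apply: eq_bigr => j _.
  by rewrite !mxE hE.
exists s, w; split=> // i j; rewrite hE sE//.
by have := ltn_ord i; have := ltn_ord j; lia.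
Qed.

(** * Truncated binomial expansions of powers *)

Section PowerApproximation.
Variable R : realType.

(* For [y = 0] this is [x ^+ k] if [k < m] and [0] otherwise. *)
Definition trunc_pow (m : nat) (y x : R) (k : nat) : R :=
  \sum_(p < m) 'C(k, p)%:R * y ^+ (k - p) * (x - y) ^+ p.

Lemma trunc_pow_full (N : nat) (y x : R) (k : nat) : (k < N)%N ->
  trunc_pow N y x k = x ^+ k.
Proof.
move=> kN; have -> : x ^+ k = (y + (x - y)) ^+ k by rewrite addrC subrK.
rewrite exprDn /trunc_pow.
rewrite (big_ord_widen N (fun p => y ^+ (k - p) * (x - y) ^+ p *+ 'C(k, p)))//.
rewrite [RHS]big_mkcond; apply: eq_bigr => p _; case: ltnP => pk.
  by rewrite -mulrA mulr_natl.
by rewrite bin_small// !mul0r.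
Qed.

(** With [d = x - y], an omitted term has [p >= m], so [d^p <= 2^-m (2d)^p], and the terms with [2d]
    sum to at most [(y + 2d)^k = (2x - y)^k]. *)
Lemma trunc_pow_error (m : nat) (y x : R) (k : nat) : 0 <= y -> y <= x ->
  0 <= x ^+ k - trunc_pow m y x k <= (2 ^+ m)^-1 * (2 * x - y) ^+ k.
Proof.
move=> y0 yx.
have d0 : 0 <= x - y by rewrite subr_ge0.
have t0 p : 0 <= 'C(k, p)%:R * y ^+ (k - p) * (x - y) ^+ p.
  by rewrite !mulr_ge0 ?exprn_ge0.
(* With [m + k.+1] terms the expansion is complete and splits after the first [m]. *)
rewrite -(@trunc_pow_full (m + k.+1) y x k); last by lia.
rewrite /trunc_pow big_split_ord /= addrAC subrr add0r.
apply/andP; split; first by apply: sumr_ge0.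
rewrite mulrC ler_pdivlMr ?exprn_gt0//.
rewrite -(@trunc_pow_full (m + k.+1) y (2 * x - y) k); last by lia.
rewrite /trunc_pow big_split_ord /= mulr_suml -[leLHS]add0r lerD//.
  by apply: sumr_ge0 => p _; rewrite !mulr_ge0 ?exprn_ge0//; lra.
apply: ler_sum => p _; rewrite -[leLHS]mulrA ler_wpM2l ?mulr_ge0 ?exprn_ge0//.
have -> : 2 * x - y - y = 2 * (x - y) by ring.
rewrite exprMn mulrC ler_wpM2r ?exprn_ge0// exprD ler_peMr ?exprn_ge0//.
by rewrite exprn_ege1// ler1n.
Qed.

Lemma bernoulli_le (b : R) (k : nat) : 0 <= b <= 1 ->
  1 - k%:R * b <= (1 - b) ^+ k.
Proof.
move=> b01; elim: k => [|k IH]; first by rewrite mul0r subr0 expr0.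
have k0 : 0 <= k%:R :> R by [].
have := ler_wpM2l (_ : 0 <= 1 - b) IH; rewrite -exprS -natr1 => /(_ ltac:(lra)).
by apply: le_trans; nra.
Qed.

(** Below the last node, [x] lies between consecutive nodes, where [(2x - y)^2 <= x]. Beyond it, the
    node is within [1/(4n)] of 1, so powers up to [2n] change by constant factors only. *)
Lemma trunc_pow_level_error (L m n : nat) (x : R) : (0 < n)%N ->
  (3/4) ^+ L <= (4 * n%:R)^-1 :> R -> 0 <= x <= 1 ->
  exists l : 'I_L.+1, forall k, (k <= n.*2)%N ->
    0 <= x ^+ k - trunc_pow m (1 - (3/4) ^+ l) x k <= 4 / 2 ^+ m * x ^+ k./2.
Proof.
move=> n0 bL x01; have [x0 x1] := andP x01.
have b01 l : 0 < (3/4 : R) ^+ l <= 1.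
  by rewrite exprn_gt0 ?exprn_ile1//; lra.
have [xL|xL] := leP (1 - (3/4) ^+ L) x.
  exists ord_max => k kn /=; set b := (3/4) ^+ L in bL xL *.
  have := b01 L; rewrite -/b => /andP[b0 b1].
  have kb : k%:R * b <= 1/2.
    have n4 : 0 < 4 * n%:R :> R by rewrite mulr_gt0 ?ltr0n.
    have : k%:R * b <= (2 * n%:R) * (4 * n%:R)^-1.
      apply: ler_pM => //; first exact: ltW.
      by rewrite -(natrM _ 2) ler_nat mul2n.
    move/le_trans; apply; rewrite ler_pdivrMr//; move: (n%:R : R) => v; clear; lra.
  have bk := @bernoulli_le b k ltac:(lra).
  have yb : 0 <= 1 - b by rewrite subr_ge0.
  have /andP[-> /le_trans->//] := trunc_pow_error m k yb xL.
  rewrite [4 / _]mulrC -mulrA ler_pM2l ?invr_gt0 ?exprn_gt0//.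
  (* (2x-y)^k <= (1+b)^k <= (1-b)^-k <= 2 and x^(k/2) >= x^k >= (1-b)^k >= 1/2 *)
  have up : (2 * x - (1 - b)) ^+ k <= 2.
    have lek : (2 * x - (1 - b)) ^+ k <= (1 + b) ^+ k.
      by rewrite lerXn2r ?nnegrE//; lra.
    apply: le_trans lek _.
    have : (1 + b) ^+ k * (1 - b) ^+ k <= 1.
      by rewrite -exprMn exprn_ile1//; nra.
    have : 0 <= (1 + b) ^+ k by rewrite exprn_ge0//; lra.
    nra.
  have lo : (1 - b) ^+ k <= x ^+ k by rewrite lerXn2r ?nnegrE.
  have lo' : x ^+ k <= x ^+ k./2 by rewrite ler_wiXn2l//; lia.
  lra.
have exl : exists l, x < 1 - (3/4) ^+ l by exists L.
(* The first node beyond [x] has positive index, since node 0 is 0; its predecessor is the node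
   sought. *)
case: (ex_minnP exl) => -[|l] xl lmin; first by move: xl; rewrite expr0 subrr ltNge x0.
have lL : (l < L.+1)%N by have := lmin L xL; lia.
have yx : 1 - (3/4) ^+ l <= x.
  by rewrite leNgt; apply/negP => /lmin; rewrite ltnn.
exists (Ordinal lL) => k kn /=; set b := (3/4) ^+ l in yx *.
have := b01 l; rewrite -/b => /andP[b0 b1].
have yb : 0 <= 1 - b by rewrite subr_ge0.
have /andP[-> /le_trans->//] := trunc_pow_error m k yb yx.
have b34 : b = 1 \/ b <= 3/4.
  rewrite /b; case: (l) => [|l']; [by left; rewrite expr0|right].
  by rewrite exprS ler_piMr//; have := b01 l'; lra.
(* The difference of the two sides is convex in [x]; at the ends [1 - b] and [1 - 3b/4] it equals
   [-b(1 - b)] and [-b(1 - b)/4]. *)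
have sq : (2 * x - (1 - b)) ^+ 2 <= x.
  move: xl; rewrite exprS -/b => xl.
  by case: b34 => [bE|b34]; [rewrite bE in xl *; nra|nra].
have z0 : 0 <= 2 * x - (1 - b) by lra.
have z1 : 2 * x - (1 - b) <= 1.
  by rewrite -(@expr_le1 _ 2)//; lra.
have zk : (2 * x - (1 - b)) ^+ k <= x ^+ k./2.
  rewrite -{1}(odd_double_half k) exprD -mul2n exprM.
  apply: le_trans (_ : 1 * ((2 * x - (1 - b)) ^+ 2) ^+ k./2 <= _).
    by rewrite ler_wpM2r ?exprn_ge0// exprn_ile1.
  by rewrite mul1r lerXn2r ?nnegrE ?sqr_ge0.
have xk : 0 <= x ^+ k./2 by rewrite exprn_ge0.
by rewrite [4 / _]mulrC -mulrA ler_wpM2l ?invr_ge0 ?exprn_ge0//; lra.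
Qed.

(* By Vandermonde's identity, [C(i+j, p) y^(i+j-p)] is the sum over [q <= p] of
   [C(i, q) y^(i-q) * C(j, p-q) y^(j-(p-q))]. *)
Lemma rank_trunc (m n : nat) (y : R) (c : 'I_m -> R) :
  (\rank (\matrix_(i < n, j < n)
     \sum_(p < m) c p * ('C(i + j, p)%:R * y ^+ (i + j - p)))%R <= m)%N.
Proof.
pose A := \matrix_(i < n, q < m) ('C(i, q)%:R * y ^+ (i - q)).
pose B := \matrix_(q < m, j < n) \sum_(p < m | (q <= p)%N)
  c p * ('C(j, p - q)%:R * y ^+ (j - (p - q))).
rewrite (_ : \matrix_(i, j) _ = A *m B).
  by rewrite (leq_trans (mxrankM_maxr _ _))// rank_leq_row.
apply/matrixP => i j; rewrite !mxE.
under [RHS]eq_bigr => q _ do rewrite !mxE mulr_sumr big_mkcond.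
rewrite [RHS]exchange_big /=; apply: eq_bigr => p _.
rewrite -big_mkcond /=.
rewrite -binomial.Vandermonde natr_sum mulr_suml mulr_sumr.
have pm : (p.+1 <= m)%N by [].
rewrite (big_ord_widen m
  (fun q => (c p * (('C(i, q) * 'C(j, p - q))%N%:R * y ^+ (i + j - p)))%R) pm).
rewrite big_mkcond [RHS]big_mkcond; apply: eq_bigr => q _; rewrite ltnS.
case: ifP => // qp; rewrite natrM.
(* Truncated subtraction splits the exponent only for [q <= i] and [p - q <= j]; otherwise a
   binomial coefficient vanishes. *)
have [iq|qi] := ltnP i q; first by rewrite bin_small// !(mul0r, mulr0).
have [jq|qj] := ltnP j (p - q); first by rewrite (@bin_small j)// !(mul0r, mulr0).
have -> : (i + j - p = (i - q) + (j - (p - q)))%N by lia.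
by rewrite exprD; ring.
Qed.

Lemma rank_sum (m n : nat) (I : finType) (A : I -> 'M[R]_n) :
  (forall i, (\rank (A i) <= m)%N) -> (\rank (\sum_i A i)%R <= m * #|I|)%N.
Proof.
move=> rA; rewrite -sum1_card big_distrr /= muln1.
elim/big_rec2: _ => [|i N B _ rB]; first by rewrite mxrank0.
by rewrite (leq_trans (mxrank_add _ _))// leq_add.
Qed.

End PowerApproximation.

(** * Approximation of one part *)

Section Halving.
Variables (R : realType) (n : nat).

Lemma half_ord_subproof (i : 'I_n) : (i./2 < n)%N.
Proof. by have := ltn_ord i; lia. Qed.

Definition half_ord (i : 'I_n) : 'I_n := Ordinal (half_ord_subproof i).

Lemma card_half_fiber (i : 'I_n) : (#|[pred j | half_ord j == i]| <= 2)%N.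
Proof.
rewrite cardE -(size_map val).
apply: (@uniq_leq_size _ _ [:: (val i).*2; (val i).*2.+1]).
  by rewrite map_inj_uniq ?enum_uniq//; exact: val_inj.
move=> _ /mapP[j + ->]; rewrite mem_enum !inE => /eqP <- /=.
by move: (j : nat) => k; lia.
Qed.

Lemma sum_half_le (F : 'I_n -> R) : (forall i, 0 <= F i) ->
  \sum_i F (half_ord i) <= 2 * \sum_i F i.
Proof.
move=> F0; rewrite (partition_big half_ord predT)//= mulr_sumr.
apply: ler_sum => i _.
rewrite (eq_bigr (fun _ => F i)); last by move=> j /eqP ->.
by rewrite sumr_const -[leLHS]mulr_natl ler_wpM2r// ler_nat card_half_fiber.
Qed.

Lemma sqnorm_fiber_le (y : 'cV[R]_n) :
  sqnorm (\col_i \sum_(j | half_ord j == i) `|y j 0|) <= 2 * sqnorm y.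
Proof.
rewrite [sqnorm y](partition_big half_ord predT)//= mulr_sumr.
apply: ler_sum => i _; rewrite mxE.
(* The doubled indicator makes Cauchy-Schwarz yield the fibre size, at most 2, times the sum of
   squares over the fibre. *)
have -> : \sum_(j | half_ord j == i) `|y j 0| =
    \sum_j (half_ord j == i)%:R * ((half_ord j == i)%:R * `|y j 0|).
  rewrite big_mkcond; apply: eq_bigr => j _.
  by case: eqP; rewrite ?mul1r ?mul0r.
apply: le_trans (cauchy_schwarz_sum _ _) _; apply: ler_pM => //.
- by apply: sumr_ge0 => j _; exact: sqr_ge0.
- by apply: sumr_ge0 => j _; exact: sqr_ge0.
- rewrite (eq_bigr (fun j => if half_ord j == i then 1 else 0)).
    by rewrite -big_mkcond sumr_const ler_nat card_half_fiber.
  by move=> j _; case: eqP; rewrite ?expr1n ?expr0n.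
rewrite [leRHS]big_mkcond; apply: ler_sum => j _.
case: eqP => _; last by rewrite mul0r expr0n.
by rewrite mul1r real_normK ?num_real.
Qed.

Variables (A E : 'M[R]_n) (d : R).
Hypothesis d0 : 0 <= d.
Hypothesis EA : forall i j, `|E i j| <= d * A (half_ord i) (half_ord j).

(** Grouping coordinates by half index bounds the form of [E] by that of [A] at the fibre sums of
    absolute values; each of the two vectors costs a factor [sqrt 2] in norm. *)
Lemma spectral_norm_half : spectral_norm E <= d * 2 * spectral_norm A.
Proof.
apply: spectral_norm_le => [|x y]; first by rewrite !mulr_ge0 ?spectral_norm_ge0.
pose fib (z : 'cV[R]_n) : 'cV[R]_n := \col_i \sum_(j | half_ord j == i) `|z j 0|.
have fib_le z : vec_norm2 (fib z) <= Num.sqrt 2 * vec_norm2 z.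
  apply: vec_norm2_le; first by rewrite mulr_ge0 ?sqrtr_ge0.
  by rewrite exprMn sqr_vec_norm2 sqr_sqrtr// sqnorm_fiber_le.
have bE : `|bil y E x| <= d * bil (fib y) A (fib x).
  apply: le_trans (_ : \sum_i \sum_j `|y i 0| * (d * A (half_ord i) (half_ord j)) * `|x j 0| <= _).
    apply: le_trans (ler_norm_sum _ _ _) _; apply: ler_sum => i _.
    apply: le_trans (ler_norm_sum _ _ _) _; apply: ler_sum => j _.
    by rewrite !normrM ler_wpM2r// ler_wpM2l.
  rewrite le_eqVlt; apply/orP; left; apply/eqP.
  rewrite /bil (partition_big half_ord predT)//= mulr_sumr; apply: eq_bigr => k _.
  rewrite exchange_big (partition_big half_ord predT)//= mulr_sumr; apply: eq_bigr => l _.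
  rewrite !mxE !mulr_suml mulr_sumr exchange_big; apply: eq_bigr => i /eqP <-.
  rewrite !mulr_sumr; apply: eq_bigr => j /eqP <-; ring.
apply: le_trans bE _; rewrite -!mulrA ler_wpM2l//.
apply: le_trans (ler_norm _) _; apply: le_trans (bil_le _ _ _) _.
rewrite [leRHS]mulrCA ler_wpM2l ?spectral_norm_ge0//.
apply: le_trans (ler_pM _ _ (fib_le y) (fib_le x)) _; rewrite ?vec_norm2_ge0//.
by rewrite mulrACA -expr2 sqr_sqrtr.
Qed.

(** Each index has at most two preimages under halving, so every squared entry of [A] is counted at
    most four times. *)
Lemma frobenius_norm_half : frobenius_norm E <= d * 2 * frobenius_norm A.
Proof.
apply: frobenius_norm_le; first by rewrite !mulr_ge0 ?frobenius_norm_ge0.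
apply: le_trans (_ : \sum_i \sum_j d ^+ 2 * A (half_ord i) (half_ord j) ^+ 2 <= _).
  apply: ler_sum => i _; apply: ler_sum => j _.
  rewrite -exprMn -[leLHS]real_normK ?num_real// lerXn2r ?nnegrE//.
  exact: le_trans (EA i j).
under eq_bigr do rewrite -mulr_sumr.
rewrite -mulr_sumr !exprMn -mulrA ler_wpM2l ?sqr_ge0// sqr_frobenius_norm.
apply: le_trans (_ : \sum_i 2 * \sum_j A (half_ord i) j ^+ 2 <= _).
  by apply: ler_sum => i _; apply: sum_half_le => j; exact: sqr_ge0.
rewrite -mulr_sumr expr2 -mulrA ler_wpM2l//.
apply: (sum_half_le (F := fun i => \sum_j A i j ^+ 2)) => i.
by apply: sumr_ge0 => j _; exact: sqr_ge0.
Qed.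

End Halving.

Section Approximation.
Variables (R : realType).

Definition hankel_approx (n : nat) (r : nat) (e f : R) (A : 'M[R]_n) :=
  exists B : 'M[R]_n, [/\ is_hankel B, (\rank B <= r)%N,
    spectral_norm (A - B) <= e & frobenius_norm (A - B) <= f].

Lemma hankel_approx_weaken n r (e f e' f' : R) (A : 'M[R]_n) :
  e <= e' -> f <= f' -> hankel_approx r e f A -> hankel_approx r e' f' A.
Proof.
move=> ee ff [B [hB rB sB fB]].
by exists B; split=> //; [exact: le_trans ee|exact: le_trans ff].
Qed.

Lemma hankel_approxD n r1 r2 (e1 f1 e2 f2 : R) (A1 A2 : 'M[R]_n) :
  hankel_approx r1 e1 f1 A1 -> hankel_approx r2 e2 f2 A2 ->
  hankel_approx (r1 + r2) (e1 + e2) (f1 + f2) (A1 + A2).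
Proof.
move=> [B1 [h1 k1 s1 g1]] [B2 [h2 k2 s2 g2]]; exists (B1 + B2).
have -> : A1 + A2 - (B1 + B2) = (A1 - B1) + (A2 - B2).
  by rewrite opprD addrACA.
split.
- by move=> i j k l ij; rewrite !mxE (h1 _ _ _ _ ij) (h2 _ _ _ _ ij).
- by rewrite (leq_trans (mxrank_add _ _))// leq_add.
- by rewrite (le_trans (spectral_normD _ _))// lerD.
- by rewrite (le_trans (frobenius_normD _ _))// lerD.
Qed.

Lemma hankel_approx_conj n r (e f : R) (Q A : 'M[R]_n) : Q^T *m Q = 1%:M ->
  (forall B : 'M[R]_n, is_hankel B -> is_hankel (Q *m B *m Q^T)) ->
  hankel_approx r e f A -> hankel_approx r e f (Q *m A *m Q^T).
Proof.
move=> QTQ hQ [B [hB rB sB fB]]; exists (Q *m B *m Q^T).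
rewrite -mulmxBl -mulmxBr; split.
- exact: hQ.
- by rewrite (leq_trans (mxrankM_maxl _ _))// (leq_trans (mxrankM_maxr _ _)).
- by rewrite spectral_norm_conj.
- by rewrite frobenius_norm_conj.
Qed.

Definition moment_mx (n : nat) (s : seq (R * R)) : 'M[R]_n :=
  \matrix_(i, j) \sum_(a <- s) a.1 * a.2 ^+ (i + j).

Definition unit_atoms (s : seq (R * R)) :=
  {in s, forall a, 0 <= a.1 /\ 0 <= a.2 <= 1}.

Lemma sum_of_squares_moment_mx n (s : seq (R * R)) :
  {in s, forall a, 0 <= a.1} -> sum_of_squares (moment_mx n s).
Proof.
move=> s0; exists [seq \col_i (Num.sqrt a.1 * a.2 ^+ i) | a <- s].
rewrite big_map; apply/matrixP => i j; rewrite mxE summxE.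
rewrite big_seq [RHS]big_seq; apply: eq_bigr => a /s0 a0.
by rewrite !mxE big_ord1 !mxE mulrACA -expr2 sqr_sqrtr// exprD.
Qed.

Lemma moment_mx_approx (L m n : nat) (s : seq (R * R)) : (0 < n)%N ->
  (3/4) ^+ L <= (4 * n%:R)^-1 :> R -> unit_atoms s ->
  let A := moment_mx n s in let d := 4 / 2 ^+ m * 2 in
  hankel_approx (m * L.+1) (d * spectral_norm A) (d * frobenius_norm A) A.
Proof.
move=> n0 bL us A d.
have /choice[lev levP] : forall x : R, exists l : 'I_L.+1, 0 <= x <= 1 ->
    forall k, (k <= n.*2)%N ->
    0 <= x ^+ k - trunc_pow m (1 - (3/4) ^+ l) x k <= 4 / 2 ^+ m * x ^+ k./2.
  (* Outside [[0, 1]] the level is an arbitrary default. *)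
  move=> x; have [x01|] := boolP (0 <= x <= 1); last by exists ord0.
  by have [l lP] := trunc_pow_level_error m n0 bL x01; exists l.
pose B : 'M[R]_n := \matrix_(i, j) \sum_(a <- s) a.1 *
  trunc_pow m (1 - (3/4) ^+ lev a.2) a.2 (i + j).
have d0 : 0 <= 4 / 2 ^+ m :> R by rewrite divr_ge0 ?exprn_ge0.
have EA (i j : 'I_n) : `|(A - B) i j| <= 4 / 2 ^+ m * A (half_ord i) (half_ord j).
  have ijn : (i + j <= n.*2)%N by have := ltn_ord i; have := ltn_ord j; lia.
  rewrite !mxE -sumrB mulr_sumr (le_trans (ler_norm_sum _ _ _))//.
  rewrite big_seq [leRHS]big_seq; apply: ler_sum => a /us[a0 a01].
  have /andP[e0 e1] := levP _ a01 _ ijn.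
  rewrite -mulrBr normrM !ger0_norm// [leRHS]mulrCA ler_wpM2l//.
  apply: le_trans e1 _; rewrite ler_wpM2l//.
  (* Powers of a number in [[0, 1]] decrease, and [i./2 + j./2 <= (i + j)./2]. *)
  by have /andP[? ?] := a01; rewrite ler_wiXn2l//=; lia.
exists B; split.
- by move=> i j k l ij; rewrite !mxE ij.
(* Grouping by node leaves the atoms only in the coefficients of the [m] terms, the shape required
   by [rank_trunc]. *)
- have -> : B = \sum_(l < L.+1) \matrix_(i, j) \sum_(p < m)
      (\sum_(a <- s | lev a.2 == l) a.1 * (a.2 - (1 - (3/4) ^+ l)) ^+ p) *
      ('C(i + j, p)%:R * (1 - (3/4) ^+ l) ^+ (i + j - p)).
    apply/matrixP => i j; rewrite mxE summxE.
    rewrite (partition_big (fun a => lev a.2) predT)//=; apply: eq_bigr => l _.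
    rewrite mxE; under [RHS]eq_bigr do rewrite mulr_suml.
    rewrite exchange_big; apply: eq_bigr => a /eqP ->.
    by rewrite mulr_sumr; apply: eq_bigr => p _; ring.
  by rewrite -[in leqRHS](card_ord L.+1); apply: rank_sum => l; exact: rank_trunc.
- exact: spectral_norm_half d0 EA.
- exact: frobenius_norm_half d0 EA.
Qed.

(** Congruence by [sign_mx] moves an atom from [x] to [-x]; congruence by [rev_mx] moves it to [1/x]
    with a rescaled weight and exchanges 0 with infinity. *)
Definition sign_mx n : 'M[R]_n := diag_mx (\row_i (-1) ^+ i).
Definition rev_mx n : 'M[R]_n := perm_mx (perm (@rev_ord_inj n)).

Lemma sign_mxE n (A : 'M[R]_n) i j :
  (sign_mx n *m A *m (sign_mx n)^T) i j = (-1) ^+ (i + j) * A i j.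
Proof.
rewrite tr_diag_mx mul_mx_diag mxE mul_diag_mx !mxE exprD; ring.
Qed.

Lemma rev_mxE n (A : 'M[R]_n) i j :
  (rev_mx n *m A *m (rev_mx n)^T) i j = A (rev_ord i) (rev_ord j).
Proof. by rewrite tr_perm_mx -row_permE -col_permE !mxE !permE. Qed.

Lemma sign_mx_orthogonal n : (sign_mx n)^T *m sign_mx n = 1%:M.
Proof.
apply/matrixP => i j; rewrite tr_diag_mx mul_diag_mx !mxE.
case: eqP => [->|_]; rewrite ?mulr0n ?mulr0// !mulr1n.
by rewrite -exprMn mulrNN mulr1 expr1n.
Qed.

Lemma rev_mx_orthogonal n : (rev_mx n)^T *m rev_mx n = 1%:M.
Proof. by rewrite tr_perm_mx -perm_mxM mulVg perm_mx1. Qed.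

Lemma sign_mx_hankel n (A : 'M[R]_n) :
  is_hankel A -> is_hankel (sign_mx n *m A *m (sign_mx n)^T).
Proof. by move=> hA i j k l ij; rewrite !sign_mxE ij (hA _ _ _ _ ij). Qed.

Lemma rev_mx_hankel n (A : 'M[R]_n) :
  is_hankel A -> is_hankel (rev_mx n *m A *m (rev_mx n)^T).
Proof.
move=> hA i j k l ij; rewrite !rev_mxE; apply: hA => /=.
by have := ltn_ord i; have := ltn_ord j; have := ltn_ord k; have := ltn_ord l; lia.
Qed.

End Approximation.

(** * Assembling the parts *)

Lemma exprn_ge_ln (R : realType) (r x : R) : 1 < r -> 1 <= x ->
  exists k : nat, x <= r ^+ k /\ k%:R <= ln x / ln r + 1.
Proof.
move=> r1 x1; have lr : 0 < ln r by rewrite ln_gt0.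
have lx : 0 <= ln x by rewrite ln_ge0.
have q0 : 0 <= ln x / ln r by rewrite divr_ge0 // ltW.
exists (Num.truncn (ln x / ln r)).+1; have /andP[lo hi] := truncn_itv q0; split.
  have rp : 0 < r by rewrite (lt_trans _ r1).
  rewrite -ler_ln ?posrE ?exprn_gt0// ?(lt_le_trans _ x1)//.
  by rewrite lnXn// -[leRHS]mulr_natl -ler_pdivrMr// ltW.
by rewrite -natr1 lerD2r.
Qed.

(** * Distribution of the atoms over four parts *)

Section FourParts.
Variables (R : realType) (N : nat).
Local Notation n := N.+1.
Local Notation S := (sign_mx R n).
Local Notation J := (rev_mx R n).

(** Atoms are sorted by [[0, 1]], [[-1, 0)], [(1, oo)] and [(-oo, -1)]. Reversal rests on
    [x^(i+j) = x^(2N) (1/x)^(2N-i-j)], where the even power keeps the weight nonnegative. *)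
Lemma atomic_four_parts (H : 'M[R]_n) (s : seq (R * R)) (w : R) :
  all (fun a => 0 <= a.1) s -> 0 <= w ->
  (forall i j, H i j = \sum_(a <- s) a.1 * a.2 ^+ (i + j)
     + w * ((i + j)%N == N.*2)%:R) ->
  exists s1 s2 s3 s4 : seq (R * R),
    [/\ unit_atoms s1, unit_atoms s2, unit_atoms s3 & unit_atoms s4] /\
    H = moment_mx n s1 + S *m moment_mx n s2 *m S^T
      + J *m moment_mx n s3 *m J^T
      + S *m (J *m moment_mx n s4 *m J^T) *m S^T.
Proof.
move=> /allP s0 w0 HE.
pose c1 (a : R * R) := 0 <= a.2 <= 1.
pose c2 (a : R * R) := -1 <= a.2 < 0.
pose c3 (a : R * R) := 1 < a.2.
pose c4 (a : R * R) := a.2 < -1.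
exists [seq a <- s | c1 a], [seq (a.1, - a.2) | a <- s & c2 a],
  (* Reversal turns the atom at infinity into an atom at 0 of weight [w]. *)
  ((w, 0) :: [seq (a.1 * a.2 ^+ N.*2, a.2^-1) | a <- s & c3 a]),
  [seq (a.1 * a.2 ^+ N.*2, - a.2^-1) | a <- s & c4 a].
have even_pow (x : R) : 0 <= x ^+ N.*2 by rewrite -mul2n exprM exprn_ge0 ?sqr_ge0.
split; first split.
- by move=> a; rewrite mem_filter => /andP[? /s0].
- move=> _ /mapP[a + ->]; rewrite mem_filter => /andP[+ /s0 a0].
  by rewrite /c2 /= => c; split=> //; lra.
- move=> b; rewrite inE => /orP[/eqP ->|]; first by rewrite /= lexx ler01.
  move=> /mapP[a + ->]; rewrite mem_filter => /andP[+ /s0 a0].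
  rewrite /c3 /= => c; split; first by rewrite mulr_ge0.
  have a2 : 0 < a.2 by lra.
  by rewrite invr_ge0 ltW//= invf_le1// ltW.
- move=> _ /mapP[a + ->]; rewrite mem_filter => /andP[+ /s0 a0].
  rewrite /c4 /= => c; split; first by rewrite mulr_ge0.
  have a2 : 0 < - a.2 by lra.
  by rewrite -invrN invr_ge0 ltW//= invf_le1//; lra.
apply/matrixP => i j; rewrite HE [RHS]mxE [X in _ = X + _]mxE [X in _ = X + _ + _]mxE.
rewrite !sign_mxE !rev_mxE ![moment_mx _ _ _ _]mxE /=.
set r := (N.+1 - i.+1 + (N.+1 - j.+1))%N.
have rE : N.*2 = (i + j + r)%N.
  by rewrite /r; have := ltn_ord i; have := ltn_ord j; lia.
have powr (x : R) : x != 0 -> x ^+ N.*2 * x^-1 ^+ r = x ^+ (i + j).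
  by move=> xn0; rewrite rE exprD exprVn mulfK// expf_neq0.
rewrite big_cons big_filter !big_map !big_filter /= expr0n.
(* As [0^0 = 1], the atom at 0 contributes exactly where the reversed index sum [r] vanishes, in the
   last corner. *)
have -> : (r == 0)%N = (i + j == N.*2)%N by rewrite rE; lia.
rewrite [w * _ + _]addrC addrA [RHS]addrAC; congr (_ + _).
rewrite [in RHS]big_mkcond [X in _ + _ * X + _]big_mkcond.
rewrite [X in _ + _ + X + _]big_mkcond [X in _ + _ * X]big_mkcond.
rewrite !mulr_sumr -!big_split /=; apply: eq_bigr => a _.
have NN k (x : R) : (-1) ^+ k * (- x) ^+ k = x ^+ k.
  by rewrite -exprMn mulN1r opprK.
rewrite /c1 /c2 /c3 /c4.
have [x0|x0] := ltP a.2 0.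
  have -> /= : (1 < a.2) = false by apply/negP => ?; lra.
  rewrite add0r addr0; have [x1|x1] := leP (-1) a.2.
    by rewrite mulr0 addr0 mulrCA NN.
  rewrite mulr0 add0r -mulrA mulrCA; congr (_ * _).
  rewrite -(powr (a.2)) ?lt_eqF// mulrCA; congr (_ * _).
  have -> : (-1) ^+ (i + j) = (-1) ^+ r :> R.
    rewrite -signr_odd -[RHS]signr_odd; have := odd_double N.
    by rewrite rE oddD; case: odd; case: odd.
  by rewrite NN.
rewrite andbF /= !mulr0 addr0.
have -> /= : (a.2 < -1) = false by apply/negP => ?; lra.
rewrite mulr0 addr0; have [x1|x1] := leP a.2 1; first by rewrite addr0.
rewrite add0r -mulrA powr// gt_eqF//; lra.
Qed.

End FourParts.

(** The sum-of-squares clause makes each part dominated by the whole in both norms, so that relative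
    errors can be added. *)
Definition good_part (R : realType) n (r : nat) (d : R) (A : 'M[R]_n) :=
  sum_of_squares A /\
  hankel_approx r (d * spectral_norm A) (d * frobenius_norm A) A.

Lemma good_part_conj (R : realType) n r (d : R) (Q A : 'M[R]_n) :
  Q^T *m Q = 1%:M ->
  (forall B : 'M[R]_n, is_hankel B -> is_hankel (Q *m B *m Q^T)) ->
  good_part r d A -> good_part r d (Q *m A *m Q^T).
Proof.
move=> QTQ hQ [sA aA]; split; first exact: sum_of_squares_conj.
by rewrite spectral_norm_conj// frobenius_norm_conj//; exact: hankel_approx_conj.
Qed.

(* Each summand is dominated by the sum in both norms. *)
Lemma good_partD (R : realType) n r1 r2 (d1 d2 : R) (A B : 'M[R]_n) :
  0 <= d1 -> 0 <= d2 ->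
  good_part r1 d1 A -> good_part r2 d2 B -> good_part (r1 + r2) (d1 + d2) (A + B).
Proof.
move=> d10 d20 [sA aA] [sB aB]; split; first exact: sum_of_squaresD.
apply: hankel_approx_weaken (hankel_approxD aA aB).
  rewrite mulrDl lerD// ler_wpM2l//; first exact: spectral_norm_sum_of_squares_le.
  by rewrite addrC; exact: spectral_norm_sum_of_squares_le.
rewrite mulrDl lerD// ler_wpM2l//; first exact: frobenius_norm_sum_of_squares_le.
by rewrite addrC; exact: frobenius_norm_sum_of_squares_le.
Qed.

Lemma psd_hankel_approx (R : realType) (L m n : nat) (H : 'M[R]_n) :
  (0 < n)%N -> (3/4) ^+ L <= (4 * n%:R)^-1 :> R -> is_hankel H -> is_psd H ->
  exists B : 'M[R]_n, [/\ is_hankel B, (\rank B <= 4 * (m * L.+1))%N,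
    spectral_norm (H - B) <= 32 / 2 ^+ m * spectral_norm H &
    frobenius_norm (H - B) <= 32 / 2 ^+ m * frobenius_norm H].
Proof.
case: n H => // N H n0 bL hH pH.
have [s [w [s0 w0 HE]]] := psd_hankel_atomic hH pH.
have [s1 [s2 [s3 [s4 [[u1 u2 u3 u4] Hsum]]]]] := atomic_four_parts s0 w0 HE.
pose r := (m * L.+1)%N; pose d : R := 4 / 2 ^+ m * 2.
have d0 : 0 <= d by rewrite mulr_ge0// divr_ge0// exprn_ge0.
have gM t : unit_atoms t -> good_part r d (moment_mx N.+1 t).
  move=> ut; split; last exact: moment_mx_approx.
  by apply: sum_of_squares_moment_mx => a /ut[].
have gS A := good_part_conj (r := r) (d := d) (A := A)
  (sign_mx_orthogonal R N.+1) (@sign_mx_hankel R _).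
have gJ A := good_part_conj (r := r) (d := d) (A := A)
  (rev_mx_orthogonal R N.+1) (@rev_mx_hankel R _).
have : good_part (r + r + r + r) (d + d + d + d) H.
  rewrite Hsum; do !apply: good_partD; rewrite ?addr_ge0//.
  - exact: gM.
  - exact/gS/gM.
  - exact/gJ/gM.
  - exact/gS/gJ/gM.
have -> : (r + r + r + r = 4 * (m * L.+1))%N by rewrite /r; lia.
have -> : d + d + d + d = 32 / 2 ^+ m by rewrite /d; ring.
by case.
Qed.

Theorem theorem1p2 (R : realType) :
  exists c : R, 0 < c /\
    forall (n : nat) (H : 'M[R]_n) (eps : R),
      (2 <= n)%N -> is_hankel H -> is_psd H -> 0 < eps -> eps < 1 ->
      exists Hhat : 'M[R]_n,
        [/\ is_hankel Hhat,
            (\rank Hhat)%:R <= c * ln (n%:R) * log_accuracy eps,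
            spectral_norm (H - Hhat) <= eps * spectral_norm H
          & frobenius_norm (H - Hhat) <= eps * frobenius_norm H].
Proof.
have l2 : 0 < ln 2 :> R by rewrite ln_gt0// ltr1n.
have l43 : 0 < ln (4/3) :> R by rewrite ln_gt0//; lra.
have l4 : 0 < ln 4 :> R by rewrite ln_gt0// ltr1n.
(* From [5 + m <= 6 + ln (1/eps) / ln 2], where both 1 and [ln (1/eps)] are at most
   [log_accuracy eps]. *)
pose c1 : R := 6 + (ln 2)^-1.
(* From [L.+1 <= ln (4n) / ln (4/3) + 2], with the constant part absorbed by [ln n / ln 2 >= 1]. *)
pose c2 : R := (ln 4 / ln (4/3) + 2) / ln 2 + (ln (4/3))^-1.
have c1p : 0 < c1 by rewrite addr_gt0 ?invr_gt0.
have c2p : 0 < c2 by rewrite addr_gt0 ?invr_gt0// divr_gt0// addr_gt0// divr_gt0.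
exists (4 * (c1 * c2)); split; first by rewrite !mulr_gt0.
move=> n H eps n2 hH pH e0 e1.
have n0 : 0 < n%:R :> R by rewrite ltr0n; lia.
have [||m [me mle]] := @exprn_ge_ln R 2 (1 / eps).
- by rewrite ltr1n.
- by rewrite ler_pdivlMr// mul1r ltW.
have [||L [Ln Lle]] := @exprn_ge_ln R (4/3) (4 * n%:R).
- lra.
- by rewrite -(natrM _ 4) ler1n; lia.
have bL : (3/4) ^+ L <= (4 * n%:R)^-1 :> R.
  have -> : 3/4 = (4/3)^-1 :> R by field.
  by rewrite exprVn lef_pV2// posrE ?mulr_gt0 ?exprn_gt0//; lra.
have [|B [hB rB sB fB]] := psd_hankel_approx (5 + m) _ bL hH pH.
  by lia.
(* The five extra terms cancel the factor [32 = 2^5]. *)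
have err : 32 / 2 ^+ (5 + m) <= eps.
  have p2 : 0 < 2 ^+ m :> R by rewrite exprn_gt0.
  have -> : 32 / 2 ^+ (5 + m) = (2 ^+ m)^-1 :> R.
    rewrite exprD (_ : 2 ^+ 5 = 32 :> R); last by ring.
    by field; rewrite gt_eqF.
  by rewrite invf_ple ?posrE// -div1r.
exists B; split => //; last 2 first.
- by rewrite (le_trans sB)// ler_wpM2r// spectral_norm_ge0.
- by rewrite (le_trans fB)// ler_wpM2r// frobenius_norm_ge0.
set E := log_accuracy eps.
have E1 : 1 <= E by rewrite /E /log_accuracy le_max lexx.
have El : ln (1 / eps) <= E by rewrite /E /log_accuracy le_max lexx orbT.
have mE : (5 + m)%:R <= c1 * E.
  have : ln (1 / eps) / ln 2 <= E / ln 2 by rewrite ler_pM2r ?invr_gt0.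
  by rewrite natrD /c1 mulrDl [_^-1 * _]mulrC; lra.
have LE : L.+1%:R <= c2 * ln n%:R.
  have lnn : ln 2 <= ln n%:R :> R by rewrite ler_ln ?posrE// ler_nat.
  pose t : R := ln 4 / ln (4/3) + 2.
  have tp : 0 < t by rewrite addr_gt0// divr_gt0.
  have tn : t <= t / ln 2 * ln n%:R by rewrite mulrAC ler_pdivlMr// ler_pM2l.
  have -> : c2 * ln n%:R = t / ln 2 * ln n%:R + ln n%:R / ln (4/3).
    by rewrite /c2 -/t mulrDl [(ln (4/3))^-1 * _]mulrC.
  apply: le_trans (lerD tn (lexx _)); rewrite -natr1 /t.
  by move: Lle; rewrite lnM ?posrE// mulrDl; lra.
apply: le_trans (_ : (4 * ((5 + m) * L.+1))%:R <= _); first by rewrite ler_nat.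
rewrite natrM natrM.
have -> : 4 * (c1 * c2) * ln n%:R * E = 4 * ((c1 * E) * (c2 * ln n%:R)) by ring.
by rewrite ler_wpM2l// ler_pM.
Qed.
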